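(* Let $\operatorname{char}\mathsf k=0$ and let $T=(1,2,\ldots,d-1,d^k,d-1,\ldots,2,1)$ ($d$ occurring $k\ge1$ times). Let $P$ and $Q$ be CIJT partitions of diagonal lengths $T$, occurring as $P=P_{\ell,A}$ and $Q=P_{\ell',A'}$ for graded Artinian complete intersections $A=R/\operatorname{Ann}F$, $A'=R/\operatorname{Ann}F'$ of Hilbert function $T$ and nonzero linear forms $\ell,\ell'\in R_1$. Then $Q\le P$ in the dominance order if and only if $\mathcal H_{Q,\ell'}\subseteq\mathcal H_{P,\ell}$, where $\mathcal H_{P,\ell}=\{i\in[0,d-1]: h^i_\ell(F)\ne0\}$ and $\mathcal H_{Q,\ell'}=\{i\in[0,d-1]: h^i_{\ell'}(F')\neq0\}$.
   Context: $\mathsf k$ is an infinite field, $R=\mathsf k[x,y]$ with the standard grading, $j=2d+k-3$. Here $T_i=i+1$ for $0\le i\le d-1$, $T_i=d$ for $d-1\le i\le d+k-2$, $T_i=j+1-i$ for $d+k-2\le i\le j$. The diagonal lengths of a partition $P=(p_1\ge\cdots\ge p_s>0)$ are $(t_0,t_1,\ldots)$ with $t_i=\#\{(r,c): 1\le r\le s,\ 1\le c\le p_r,\ r+c-2=i\}$. The Jordan type $P_{\ell,A}$ is the partition of Jordan block sizes of multiplication by $\ell$ on $A$. A CIJT partition of diagonal lengths $T$ is a partition of diagonal lengths $T$ equal to $P_{\ell,A}$ for some graded Artinian complete intersection quotient $A$ of $R$ and nonzero linear form $\ell$. Dominance order on partitions of the same integer: $(q_1\ge\cdots\ge q_{t'})\le(p_1\ge\cdots\ge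 p_t)$ iff $\sum_{u=1}^iq_u\le\sum_{u=1}^ip_u$ for all $i\le\min\{t,t'\}$. $R$ acts on $\mathcal E=\mathsf k[X,Y]$ by differentiation ($x=\partial_X$, $y=\partial_Y$), written $f\circ F$; $F\in\mathcal E_j$ and $\operatorname{Ann}F=\{f\in R: f\circ F=0\}$. For $0\le i\le d-1$, given a basis $(\alpha_1,\ldots,\alpha_{i+1})$ of $A_i$, the $i$-th Hessian is $h^i(F)=\det[\alpha_u\alpha_v\circ F]_{u,v}$, well defined up to a nonzero scalar; for $\ell=ax+by$, $h^i_\ell(F)$ is its value at $(X,Y)=(a,b)$ (nonzero iff multiplication by $\ell^{j-2i}:A_i\to A_{j-i}$ is an isomorphism). *)

(* Defs.v *)
From mathcomp Require Import all_boot all_order all_algebra all_field.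
From mathcomp.multinomials Require Import mpoly.

Set Implicit Arguments.
Unset Strict Implicit.
Unset Printing Implicit Defensive.

Import GRing.Theory.
Local Open Scope ring_scope.

Definition is_partition (P : seq nat) : bool :=
  sorted geq P && (0%N \notin P).

(* Boxes (row, column) of the Ferrers diagram, both numbered from 0. *)
Definition cells (P : seq nat) : seq (nat * nat) :=
  [seq (r, c) | r <- iota 0 (size P), c <- iota 0 (nth 0%N P r)].

Definition diag_length (P : seq nat) (i : nat) : nat :=
  count (fun rc => rc.1 + rc.2 == i)%N (cells P).

Definition has_diag_lengths (T P : seq nat) : Prop :=
  forall i, diag_length P i = nth 0%N T i.

Definition dominance_le (Q P : seq nat) : Prop :=
  forall i, (i <= minn (size Q) (size P))%N ->
    (sumn (take i Q) <= sumn (take i P))%N.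

(* Sequences T are lists, extended by 0. *)
Definition hilbT (d k : nat) : seq nat :=
  iota 1 d.-1 ++ nseq k d ++ rev (iota 1 d.-1).

Definition in_ideal (S : comNzRingType) (s : seq S) (f : S) : Prop :=
  exists c : nat -> S, f = \sum_(i < size s) c i * s`_i.

Definition regular_sequence (S : comNzRingType) (s : seq S) : Prop :=
  (forall i, (i < size s)%N -> forall f : S,
     in_ideal (take i s) (s`_i * f) -> in_ideal (take i s) f)
  /\ ~ in_ideal s 1.

(** Jordan types.  The blocks of a nilpotent endomorphism phi have sizes
    p_0 >= p_1 >= ... iff there are vectors z_r with phi^(p_r) z_r = 0 such
    that the phi^c z_r (c < p_r) form a basis. *)

Definition nilp_jordan_type (K : fieldType) (V : vectType K)
    (phi : 'End(V)) (P : seq nat) : Prop :=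
  is_partition P /\
  exists z : nat -> V,
    (forall r, (r < size P)%N -> iter (nth 0%N P r) phi (z r) = 0) /\
    basis_of fullv [seq iter rc.2 phi (z rc.1) | rc <- cells P].

(** Artinian quotients of R = K[x,y].  Such a quotient is presented by a
    surjective algebra morphism pi from R to an algebra A; finite dimension
    over K (the Artinian property) is part of [falgType]. *)

Section Quotients.
Variables (K : fieldType) (A : falgType K).
Variable pi : {lrmorphism {mpoly K[2]} -> A}.

Definition is_quotient : Prop := forall a : A, exists f, pi f = a.

Definition graded_ci : Prop :=
  is_quotient /\
  exists s : seq {mpoly K[2]},
    [/\ forall f, f \in s -> exists e, f \is e.-homog,
        regular_sequence s
      & forall f, pi f = 0 <-> in_ideal s f].

(* The image A_i of the space R_i of forms of degree i. *)
Definition gr_piece (i : nat) : {vspace A} :=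
  <<[seq pi ('X_ord0 ^+ a * 'X_ord_max ^+ (i - a))%R | a <- iota 0 i.+1]>>%VS.

Definition has_hilbert_function (T : seq nat) : Prop :=
  forall i, \dim (gr_piece i) = nth 0%N T i.

Definition is_linear_form (ell : {mpoly K[2]}) : Prop :=
  ell \is 1.-homog /\ ell != 0.

Definition has_jordan_type (ell : {mpoly K[2]}) (P : seq nat) : Prop :=
  nilp_jordan_type (amull (pi ell)) P.

(* Elements of A_i are given by representatives in R. *)
Definition represents_basis (i n : nat) (alpha : 'I_n -> {mpoly K[2]}) : Prop :=
  basis_of (gr_piece i) [seq pi (alpha u) | u <- enum 'I_n].

End Quotients.

Definition is_CIJT (K : fieldType) (T P : seq nat) : Prop :=
  [/\ is_partition P, has_diag_lengths T P
    & exists (A : falgType K) (pi : {lrmorphism {mpoly K[2]} -> A})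
        (ell : {mpoly K[2]}),
        [/\ graded_ci pi, is_linear_form ell & has_jordan_type pi ell P]].

Section Hessians.
Variable K : fieldType.

(* f o F, with x acting as d/dX and y as d/dY; K[X,Y] is the same type as R. *)
Definition diff_act (f F : {mpoly K[2]}) : {mpoly K[2]} :=
  \sum_(m <- msupp f) f@_m *: F^`M[m].

Definition kernel_is_Ann (A : falgType K)
    (pi : {lrmorphism {mpoly K[2]} -> A}) (F : {mpoly K[2]}) : Prop :=
  forall f, pi f = 0 <-> diff_act f F = 0.

Definition hessian (n : nat) (alpha : 'I_n -> {mpoly K[2]})
    (F : {mpoly K[2]}) : {mpoly K[2]} :=
  \det (\matrix_(u < n, v < n) diff_act (alpha u * alpha v) F).

(* The point (a, b) attached to ell = a x + b y. *)
Definition point_of (ell : {mpoly K[2]}) : 'I_2 -> K := fun i => ell@_U_(i).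

Definition hess_set (d : nat)
    (alpha : forall i : 'I_d, 'I_i.+1 -> {mpoly K[2]})
    (F ell : {mpoly K[2]}) : {set 'I_d} :=
  [set i : 'I_d | (hessian (alpha i) F).@[point_of ell] != 0].

End Hessians.

(* Main.v *)
From HB Require Import structures.
Require Import Defs.
From mathcomp Require Import all_boot all_order all_algebra all_field.
From mathcomp.multinomials Require Import ssrcomplements mpoly.
From mathcomp Require Import zify.
Import GRing.Theory.
Local Open Scope ring_scope.

Set Implicit Arguments.
Unset Strict Implicit.
Unset Printing Implicit Defensive.

(** Complete ell to a basis (ell, t) of the linear forms and put
    b_s = (ell^(j-s) t^s) o F.  By Gorenstein duality the rank of ell^m on A
    is the sum of the ranks of the Hankel matrices of sizes (i+1) x (n-i) of
    the truncated sequence b_0, ..., b_(n-1), n = j+1-m, and the i-th Hessian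
    at ell is, up to a nonzero factor, the Hankel determinant
    det (b_(u+v))_(u, v <= i).
    All Hankel ranks of the truncation are determined by its apolar order
    e(n), the least degree of a form annihilating it: they equal
    min (i+1, n-i, e(n)), so the rank of ell^m is a strictly increasing
    function of e(n), and i lies in the Hessian set iff e(2i+1) = i+1, the
    largest possible value.
    When n decreases by one, e(n) drops by at most one, and once it fails to
    drop it remains constant until it reaches the largest possible value, at
    n = 2e-1.  Since e(j+1) = d, inclusion of Hessian sets is therefore
    equivalent to the pointwise comparison of the functions e, hence of the
    ranks of all powers, hence to dominance of the Jordan types. *)

(** * Ranks of Hankel matrices *)

Section Hankel.
Variables (K : fieldType) (b : nat -> K).

Definition hankel p q : 'M[K]_(p, q) := \matrix_(u < p, v < q) b (u + v).

Lemma mxrank_hankelC p q : \rank (hankel p q) = \rank (hankel q p).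
Proof.
rewrite -mxrank_tr; congr (\rank _).
by apply/matrixP => u v; rewrite !mxE addnC.
Qed.

(** [f] is a dehomogenized binary form of degree [i]. Bounding its size instead of fixing it admits
    forms divisible by the homogenizing variable. The conditions say that this form annihilates the
    truncation of [b] to length [n]. *)
Definition apolar n i (f : {poly K}) :=
  (size f <= i.+1)%N /\
  forall v, (v < n - i)%N -> \sum_(u < size f) f`_u * b (u + v) = 0.

Lemma poly_pair_widen p (f : {poly K}) v : (size f <= p)%N ->
  \sum_(u < size f) f`_u * b (u + v) = \sum_(u < p) f`_u * b (u + v).
Proof.
move=> le_fp; rewrite (big_ord_widen _ (fun u => f`_u * b (u + v)) le_fp).
rewrite big_mkcond; apply: eq_bigr => u _; case: ltnP => // le_fu.
by rewrite nth_default // mul0r.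
Qed.

Lemma apolarP n i (f : {poly K}) : (size f <= i.+1)%N ->
  apolar n i f <-> poly_rV f *m hankel i.+1 (n - i) = 0.
Proof.
move=> le_fi; split=> [[_ f0]|f0].
  apply/rowP => v; rewrite !mxE -[RHS](f0 v) // (poly_pair_widen _ le_fi).
  by apply: eq_bigr => u _; rewrite !mxE.
split=> // v lt_v; move/rowP/(_ (Ordinal lt_v)): f0; rewrite !mxE => f0.
rewrite (poly_pair_widen _ le_fi) -[RHS]f0.
by apply: eq_bigr => u _; rewrite !mxE.
Qed.

Lemma row_free_hankelP n i :
  reflect (forall f, apolar n i f -> f = 0) (row_free (hankel i.+1 (n - i))).
Proof.
apply: (iffP idP) => [free f af|free0].
  have [le_f _] := af; move/(apolarP _ le_f)/eqP: af.
  rewrite mulmx_free_eq0 // => /eqP f0.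
  by rewrite -(poly_rV_K le_f) f0 linear0.
rewrite -kermx_eq0; apply/rowV0P => c /sub_kermxP c0.
apply: (can_inj rVpolyK); rewrite linear0; apply: free0.
have le_c : (size (rVpoly c) <= i.+1)%N by apply: size_poly.
by apply/(apolarP _ le_c); rewrite rVpolyK.
Qed.

Lemma hankel_dependent n : exists i, ~~ row_free (hankel i.+1 (n - i)).
Proof.
by exists n; rewrite /row_free neq_ltn ltnS (leq_trans (rank_leq_col _)) ?subnn.
Qed.

(* With [N = n.-1], the order of the apolar ideal of the binary form of degree
   [N] with divided-power coefficients [b 0, ..., b N]. *)
Definition apolar_order n := ex_minn (hankel_dependent n).
Local Notation e := apolar_order.

Lemma apolarS n i f : apolar n i f -> apolar n i.+1 f.
Proof. by case=> le_f f0; split=> [|v lt_v]; [lia|apply: f0; lia]. Qed.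

(** By [apolarS] a nonzero annihilator in one degree persists in all higher degrees, so the least
    dependent index is a threshold. *)
Lemma row_free_hankel n i : row_free (hankel i.+1 (n - i)) = (i < e n)%N.
Proof.
rewrite /apolar_order; case: ex_minnP => m nfree_m min_m.
apply/idP/idP => [free_i|lt_im]; last by apply/negPn/negP => /min_m; rewrite leqNgt lt_im.
rewrite ltnNge; apply: contra nfree_m => le_mi.
apply/row_free_hankelP => f af; move/row_free_hankelP: free_i; apply.
by rewrite -(subnKC le_mi); elim: (i - m)%N => [|k IHk]; rewrite ?addn0 // addnS; apply: apolarS.
Qed.

Lemma apolar_order_le n i f : apolar n i f -> f != 0 -> (e n <= i)%N.
Proof.
move=> af nz_f; rewrite leqNgt -row_free_hankel; apply/row_free_hankelP => /(_ f af) f0.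
by rewrite f0 eqxx in nz_f.
Qed.

Lemma apolar_orderP n i : (e n <= i)%N -> exists2 f, f != 0 & apolar n i f.
Proof.
rewrite leqNgt -row_free_hankel -kermx_eq0 => /rowV0Pn[c /sub_kermxP c0 nz_c].
have le_c : (size (rVpoly c) <= i.+1)%N by apply: size_poly.
exists (rVpoly c); last by apply/(apolarP _ le_c); rewrite rVpolyK.
by apply: contra nz_c => /eqP c00; rewrite -[c]rVpolyK c00 linear0.
Qed.

Lemma apolar_order_homo n : (e n <= e n.+1)%N.
Proof.
have [f nz_f [le_f f0]] := apolar_orderP (leqnn (e n.+1)).
by apply: (@apolar_order_le _ _ f) => //; split=> // v lt_v; apply: f0; lia.
Qed.

Lemma apolar_order_mono m n : (m <= n)%N -> (e m <= e n)%N.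
Proof. exact: (@homo_leq _ e leq leqnn leq_trans apolar_order_homo). Qed.

(** The same polynomial read one degree higher meets the same conditions, since
    [n.+1 - i.+1 = n - i]. *)
Lemma apolar_orderS n : (e n.+1 <= (e n).+1)%N.
Proof.
have [f nz_f [le_f f0]] := apolar_orderP (leqnn (e n)).
by apply: (@apolar_order_le _ _ f) => //; split=> [|v]; [apply: leqW|rewrite subSS; apply: f0].
Qed.

Lemma apolar_order_bound n : (2 * e n <= n.+1)%N.
Proof.
case E: (e n) => [//|i].
have /eqP rk : row_free (hankel i.+1 (n - i)) by rewrite row_free_hankel E.
by have := rank_leq_col (hankel i.+1 (n - i)); rewrite rk; lia.
Qed.


(* If [s] is the top degree occurring in the kernel [W] and [f] in [W] attains
   it, then the new kernel contains [W] and also ['X * f], which is not in [W]. *)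
Lemma mxrank_hankel_shift p q : ~~ row_free (hankel p q.+1) ->
  (\rank (hankel p.+1 q) <= \rank (hankel p q.+1))%N.
Proof.
set W := kermx (hankel p q.+1); rewrite -kermx_eq0 => nz_W.
have WP (c : 'rV_p) : (c <= W)%MS ->
    forall v, (v < q.+1)%N -> \sum_(u < p) c 0 u * b (u + v) = 0.
  move=> /sub_kermxP c0 v lt_v; move/rowP/(_ (Ordinal lt_v)): c0; rewrite !mxE => c0; rewrite -[RHS]c0.
  by apply: eq_bigr => u _; rewrite !mxE.
have [f [s [Wf nz_fs max_s]]] : exists (f : 'rV_p) (s : 'I_p), [/\ (f <= W)%MS, f 0 s != 0
    & forall (c : 'rV_p) (u : 'I_p), (c <= W)%MS -> (s < u)%N -> c 0 u = 0].
  have /matrix0Pn[i0 [s0 nz0]] := nz_W.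
  have s0P : [exists i, W i s0 != 0] by apply/existsP; exists i0.
  case: (@arg_maxnP _ s0 (fun s => [exists i, W i s != 0]) val s0P) => s /existsP[i nz_s] s_max.
  exists (row i W), s; split; [exact: row_sub | by rewrite mxE |].
  move=> c u /submxP[D ->] lt_su; rewrite mxE big1 // => w _.
  suff -> : W w u = 0 by rewrite mulr0.
  apply/eqP/negPn/negP => nz_u; have: [exists i, W i u != 0] by apply/existsP; exists w.
  by move/s_max; rewrite /= leqNgt lt_su.
pose E : 'M[K]_(p, p.+1) := pid_mx p.
have EE (c : 'rV_p) (u : 'I_p.+1) :
    (c *m E) 0 u = if insub (val u) is Some u' then c 0 u' else 0.
  rewrite mxE; case: insubP => [u' _ Eu|nlt_u].
    rewrite (bigD1 u') //= big1 ?addr0 => [|w /negPf nw]; rewrite mxE.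
      by rewrite Eu eqxx -Eu ltn_ord mulr1.
    by rewrite -Eu (inj_eq val_inj) nw mulr0.
  rewrite big1 // => w _; rewrite mxE; case: eqP => [Ew|_]; rewrite ?mulr0 //.
  by rewrite /= -Ew ltn_ord in nlt_u.
pose tf : 'rV[K]_p.+1 := \row_u if val u is u'.+1 then
  (if insub u' is Some w then f 0 w else 0) else 0.
have tf_ker : (tf <= kermx (hankel p.+1 q))%MS.
  apply/sub_kermxP/rowP => v; rewrite !mxE big_ord_recl !mxE mul0r add0r.
  rewrite -[RHS](WP f Wf v.+1) ?ltnS ?ltn_ord //. apply: eq_bigr => u _.
  by rewrite !mxE lift0 /= valK addnS addSn.
have sub_ker : (W *m E <= kermx (hankel p.+1 q))%MS.
  apply/row_subP => i; rewrite row_mul; apply/sub_kermxP/rowP => v; rewrite mxE.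
  have Wi : (row i W <= W)%MS by apply: row_sub.
  rewrite !mxE big_ord_recr /= EE insubF ?ltnn // mul0r addr0.
  rewrite -[RHS](WP _ Wi v) ?ltnS 1?ltnW ?ltn_ord //; apply: eq_bigr => u _.
  by rewrite EE /= valK !mxE.
have rkE : \rank (W *m E) = \rank W.
  by rewrite mxrankMfree // /row_free rank_pid_mx.
have lt_ker : (\rank (W *m E) < \rank (kermx (hankel p.+1 q)))%N.
  apply: rank_ltmx; rewrite ltmxE sub_ker; apply: contra nz_fs => le_ker.
  have /submxP[D tfE] := submx_trans tf_ker le_ker.
  have tf_s : tf 0 (lift ord0 s) = f 0 s by rewrite mxE /= valK.
  rewrite -tf_s tfE mulmxA EE; case: insubP => // w _ Ew.
  by rewrite max_s ?submxMl // Ew /=.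
(* One row is added and the kernel grows by at least one dimension, so the rank cannot grow. *)
by move: lt_ker (rank_leq_row (hankel p q.+1)); rewrite rkE !mxrank_ker; lia.
Qed.

Lemma mxrank_hankel_anti n i i' : (e n <= i)%N -> (i <= i')%N ->
  (\rank (hankel i'.+1 (n - i')) <= \rank (hankel i.+1 (n - i)))%N.
Proof.
move=> le_ei; elim: i' => [|i' IHi]; first by rewrite leqn0 => /eqP->.
rewrite leq_eqVlt => /predU1P[-> //|le_ii]; apply: leq_trans (IHi le_ii).
case: (ltnP i' n) => [lt_in|le_ni]; last first.
  by rewrite (leq_trans (rank_leq_col _)) // (eqnP (leqW le_ni)).
rewrite -(subnSK lt_in); apply: mxrank_hankel_shift.
by rewrite subnSK // row_free_hankel -leqNgt (leq_trans le_ei).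
Qed.

(** Below [e n] the rows are free, and transposition gives the symmetric range of large [i]. In
    between, the rank is nonincreasing in [i]: it is at most [e n] at index [e n], where the rows
    are dependent, and equals [e n] at index [n - e n], the transpose of a row-free case. *)
Lemma mxrank_hankel n i :
  \rank (hankel i.+1 (n - i)) = minn (minn i.+1 (n - i)) (e n).
Proof.
have bd := apolar_order_bound n; have [e0|e_gt0] := posnP (e n).
  have := @mxrank_hankel_anti n 0 i; rewrite e0 minn0 => /(_ isT isT).
  have : ~~ row_free (hankel 1 (n - 0)) by rewrite row_free_hankel e0.
  rewrite /row_free neq_ltn => /orP[|]; last by rewrite ltnNge rank_leq_row.
  by rewrite ltnS leqn0 => /eqP-> /[!leqn0]/eqP.
have small k : (k < e n)%N -> \rank (hankel k.+1 (n - k)) = k.+1.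
  by rewrite -row_free_hankel => /eqP.
have large k : (k < e n)%N -> \rank (hankel (n - k.+1).+1 (n - (n - k.+1))) = k.+1.
  move=> lt_ke; have lt_kn : (k < n)%N by lia.
  by rewrite subnSK // subKn // mxrank_hankelC small.
case: (ltnP i (e n)) => [lt_ie|le_ei]; first by rewrite small //; lia.
case: (leqP n i) => [le_ni|lt_in].
  by apply/eqP; rewrite (_ : minn _ _ = 0)%N -?leqn0 1?(leq_trans (rank_leq_col _)) //; lia.
case: (ltnP (n - i.+1) (e n)) => [lt_e|le_e].
  have := large _ lt_e; rewrite (_ : n - (n - i.+1).+1 = i)%N; last by lia.
  by move->; lia.
apply/eqP; rewrite eqn_leq (_ : minn _ _ = e n); last by lia.
apply/andP; split.
  apply: leq_trans (mxrank_hankel_anti (leqnn (e n)) le_ei) _.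
  have : ~~ row_free (hankel (e n).+1 (n - e n)) by rewrite row_free_hankel ltnn.
  by rewrite /row_free neq_ltn -ltnS => /orP[|] //; rewrite ltnNge rank_leq_row.
have lt_e1 : ((e n).-1 < e n)%N by lia.
have := large _ lt_e1; rewrite prednK // => {1}<-.
by apply: mxrank_hankel_anti; lia.
Qed.

(** Write [e n.+1 = i.+1]. If [e n] were smaller, some nonzero [f] of degree [i] would be apolar at
    length [n], while some nonzero [g] of degree [i.+1] is apolar at length [n.+2]. Both lie in the
    kernel of one matrix with [i.+2] rows, whose rank is [i.+1] by the second hypothesis. So [f] is
    a multiple of [g], and is then apolar in degree [i] at length [n.+1], which is absurd. *)
Lemma apolar_order_stable n : e n.+1 = e n.+2 -> (2 * e n.+1 <= n.+1)%N -> e n = e n.+1.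
Proof.
move=> eS le_e; apply/eqP; rewrite eqn_leq apolar_order_homo leqNgt; apply/negP => lt_e.
have e_gt0 : (0 < e n.+1)%N by lia.
set i := (e n.+1).-1; have Ei : e n.+1 = i.+1 by rewrite prednK.
have [f nz_f af] : exists2 f, f != 0 & apolar n i f by apply: apolar_orderP; lia.
have [g nz_g ag] : exists2 g, g != 0 & apolar n.+2 i.+1 g by apply: apolar_orderP; lia.
have [le_f f0] := af; have [le_g g0] := ag.
have kf : poly_rV f *m hankel i.+2 (n.+1 - i.+1) = 0.
  apply/apolarP; first exact: leqW.
  by split=> [|v]; [apply: leqW | rewrite subSS; apply: f0].
have kg : poly_rV g *m hankel i.+2 (n.+1 - i.+1) = 0.
  by apply/apolarP; [|split=> // v lt_v; apply: g0; lia].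
have nz_gv : (poly_rV g : 'rV[K]_i.+2) != 0.
  by apply: contra nz_g => /eqP g00; rewrite -(poly_rV_K le_g) g00 linear0.
have ker1 : (kermx (hankel i.+2 (n.+1 - i.+1)) <= (poly_rV g : 'rV_i.+2))%MS.
  have sub_g : ((poly_rV g : 'rV_i.+2) <= kermx (hankel i.+2 (n.+1 - i.+1)))%MS.
    exact/sub_kermxP.
  rewrite -(geq_leqif (mxrank_leqif_sup sub_g)) mxrank_ker mxrank_hankel Ei rank_rV nz_gv; lia.
have /sub_rVP[c fE] : ((poly_rV f : 'rV_i.+2) <= (poly_rV g : 'rV_i.+2))%MS.
  by apply: submx_trans ker1; apply/sub_kermxP.
have af' : apolar n.+1 i f.
  split=> // v lt_v; suff [_] : apolar n.+2 i.+1 f by apply; lia.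
  have le_f1 : (size f <= i.+2)%N by apply: leqW.
  apply/(apolarP _ le_f1); rewrite fE -scalemxAl.
  by have /(apolarP _ le_g)-> := ag; rewrite scaler0.
by have := apolar_order_le af' nz_f; rewrite Ei ltnn.
Qed.

(** [apolar_order_stable] carries the plateau down until [2 * e n] exceeds the length; by
    [apolar_order_bound] that length is then [2 * e n - 1]. *)
Lemma apolar_order_plateau n : (0 < e n)%N -> e n = e n.+1 ->
  e (2 * e n).-1 = e n.
Proof.
elim: n => [|n IHn] e_gt0 eS; first by have := apolar_order_bound 0; lia.
have bd := apolar_order_bound n.+1.
have [lt_e|le_e] := ltnP n.+1 (2 * e n.+1); first by congr e; lia.
have en := apolar_order_stable eS le_e.
by rewrite -en IHn // en.
Qed.

End Hankel.

(* If the order [e b'] exceeded [e b] at some [n], take the largest such [n]: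
   there [e b'] is constant from [n.+1] to [n], so it stays constant until it
   reaches its maximal value at [2 * e - 1], where [e b] is smaller. *)
Lemma apolar_order_le_of_hits (K : fieldType) (b b' : nat -> K) (d n0 : nat) :
  apolar_order b n0 = d -> apolar_order b' n0 = d ->
  (forall i, (i < d)%N -> apolar_order b' (2 * i).+1 = i.+1 ->
     apolar_order b (2 * i).+1 = i.+1) ->
  forall n, (n <= n0)%N -> (apolar_order b' n <= apolar_order b n)%N.
Proof.
move=> bd b'd hits; set e := apolar_order b in bd hits *; set e' := apolar_order b' in b'd hits *.
suff H k : (k <= n0)%N -> (e' (n0 - k) <= e (n0 - k))%N.
  by move=> n le_n; rewrite -(subKn le_n) H ?leq_subr.
elim: k => [|k IHk] lt_k; first by rewrite subn0 bd b'd.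
have := IHk (ltnW lt_k); rewrite -(subnSK lt_k); set n := (n0 - k.+1)%N => le_S.
rewrite leqNgt; apply/negP => lt_e.
have := apolar_order_homo b' n; have := apolar_orderS b n; rewrite -/e -/e' => eS e'S.
(* Squeezed by [e n < e' n <= e' n.+1 <= e n.+1 <= (e n).+1]. *)
have e'E : e' n = e' n.+1 by lia.
have e'0 : (0 < e' n)%N by lia.
have := apolar_order_plateau e'0 e'E; rewrite -/e' => pl.
have le_d : (e' n <= d)%N by rewrite -b'd; apply: apolar_order_mono; apply: leq_subr.
have hit : e (2 * (e' n).-1).+1 = (e' n).-1.+1.
  by apply: hits; [lia | rewrite prednK // -[RHS]pl; congr e'; lia].
have := apolar_order_bound b' n; rewrite -/e' => bd'.
have := @apolar_order_mono K b (2 * (e' n).-1).+1 n; rewrite -/e hit; lia.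
Qed.

(** Each summand is monotone in the order. If [e < e'], the summand at [i = e] is strictly larger
    for [e']: the bound on [e'] gives [e < n - e], so the values are [e] and [e.+1]. *)
Lemma sum_minn_mono (e e' N n : nat) : (n <= N)%N -> (2 * e <= n.+1)%N -> (2 * e' <= n.+1)%N ->
  (\sum_(i < N) minn (minn i.+1 (n - i)) e' <= \sum_(i < N) minn (minn i.+1 (n - i)) e)%N
  = (e' <= e)%N.
Proof.
move=> le_nN le_e le_e'; apply/idP/idP => [|le_ee]; last first.
  by apply: leq_sum => i _; lia.
apply: contraLR; rewrite -!ltnNge => lt_e.
have lt_eN : (e < N)%N by lia.
rewrite (bigD1 (Ordinal lt_eN)) //= [X in (_ < X)%N](bigD1 (Ordinal lt_eN)) //=.
rewrite -addSn; apply: leq_add; first by lia.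
by apply: leq_sum => i _; lia.
Qed.

(** * Dominance and ranks of powers *)

(** For a Jordan type this is the rank of the [m]-th power. The subtraction is truncated at 0. *)
Definition excess (P : seq nat) m := (\sum_(p <- P) (p - m))%N.

Lemma sumn_take_le_excess (P : seq nat) i m : (sumn (take i P) <= excess P m + i * m)%N.
Proof.
rewrite /excess; elim: P i => [|p P IHP] [|i] //=; rewrite big_cons.
by have := IHP i; lia.
Qed.

(** When [m] separates the first [i] parts from the others, truncation loses nothing on the former
    and kills the latter. This is the equality case of [sumn_take_le_excess]. *)
Lemma excess_le_sumn_take (P : seq nat) i m :
  (forall r, (r < i)%N -> (m <= nth 0%N P r)%N) ->
  (forall r, (i <= r)%N -> (nth 0%N P r <= m)%N) ->
  (excess P m + i * m <= sumn (take i P))%N.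
Proof.
rewrite /excess; elim: P i => [|p P IHP] [|i] /= le_m ge_m; rewrite ?big_nil ?big_cons //.
(* Past the last part the default value 0 forces [m = 0]. *)
- by have := le_m i (leqnn _); rewrite nth_nil; nia.
- have lt0 r : (r < 0)%N -> (m <= nth 0%N P r)%N by [].
  have := ge_m 0%N isT; have := IHP 0%N lt0 (fun r _ => ge_m r.+1 isT).
  by rewrite take0 /=; lia.
have := le_m 0%N isT; have := IHP i (fun r lt_r => le_m r.+1 lt_r) (fun r le_r => ge_m r.+1 le_r).
by rewrite /=; lia.
Qed.

Lemma partition_nth_anti (P : seq nat) r s : is_partition P -> (r <= s)%N ->
  (nth 0%N P s <= nth 0%N P r)%N.
Proof.
case/andP=> sortP _ le_rs; case: (ltnP s (size P)) => [lt_s|le_s].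
  have geq_trans : transitive geq by move=> x y z /= le1 le2; apply: leq_trans le2 le1.
  have geqnn : reflexive geq by move=> x; apply: leqnn.
  by apply: (sorted_leq_nth geq_trans geqnn 0%N sortP); rewrite ?inE //; apply: leq_ltn_trans lt_s.
by rewrite (@nth_default _ _ _ s).
Qed.

(** A discrete Legendre duality between partial sums and excesses. Given [m], cut [Q] after its
    parts exceeding [m]; given [i], take for [m] the part of [P] at index [i]. *)
Lemma dominance_leP (P Q : seq nat) : is_partition P -> is_partition Q ->
  sumn P = sumn Q ->
  dominance_le Q P <-> forall m, (excess Q m <= excess P m)%N.
Proof.
move=> partP partQ eqPQ; split=> [dom m | le_ex i _].
- have [s [s_lt s_ge]] : exists s, (forall r, (r < s)%N -> (m <= nth 0%N Q r)%N) /\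
      (forall r, (s <= r)%N -> (nth 0%N Q r <= m)%N).
    have ex_s : exists s, (nth 0%N Q s <= m)%N by exists (size Q); rewrite nth_default.
    case: (ex_minnP ex_s) => s le_s min_s; exists s; split=> r.
      by move=> lt_r; rewrite leqNgt; apply/negP => /ltnW/min_s; lia.
    by move=> le_r; apply: leq_trans le_s; apply: partition_nth_anti.
  have := excess_le_sumn_take s_lt s_ge; have := sumn_take_le_excess P s m.
  suff : (sumn (take s Q) <= sumn (take s P))%N by lia.
  have sum_take (S : seq nat) : (sumn (take s S) <= sumn S)%N.
    by rewrite -{2}(cat_take_drop s S) sumn_cat leq_addr.
  (* [dominance_le] stops at the shorter length. Beyond it, either [P] is exhausted and equality of
     the totals suffices, or [Q] is, and its total is compared at [size Q]. *)
  case: (leqP (size P) s) => [le_Ps|lt_sP]; first by rewrite [take s P]take_oversize // eqPQ.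
  case: (leqP (size Q) s) => [le_Qs|lt_sQ]; last by apply: dom; lia.
  rewrite take_oversize //; apply: leq_trans (_ : sumn (take (size Q) P) <= _)%N.
    by rewrite -{1}(take_size Q) dom //; lia.
  by rewrite -(cat_take_drop (size Q) (take s P)) sumn_cat take_takel // leq_addr.
have m_lt r : (r < i)%N -> (nth 0%N P i <= nth 0%N P r)%N.
  by move=> lt_r; apply: partition_nth_anti; rewrite // ltnW.
have m_ge r : (i <= r)%N -> (nth 0%N P r <= nth 0%N P i)%N by apply: partition_nth_anti.
have := excess_le_sumn_take m_lt m_ge; have := sumn_take_le_excess Q i (nth 0%N P i).
by have := le_ex (nth 0%N P i); lia.
Qed.

Lemma excess0 P : excess P 0 = sumn P.
Proof. by rewrite /excess sumnE; apply: eq_bigr => p _; rewrite subn0. Qed.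

Lemma count_cells (P : seq nat) m : count (fun rc => m <= rc.2)%N (cells P) = excess P m.
Proof.
have row (r q : nat) : count (fun c => m <= c)%N (iota 0 q) = (q - m)%N.
  elim: q => // q IHq; rewrite -addn1 iotaD count_cat IHq /= add0n addn0; lia.
rewrite /cells count_flatten -map_comp /excess sumnE big_map.
rewrite [RHS](big_nth 0%N) /index_iota subn0.
by apply: eq_bigr => r _ /=; rewrite count_map; apply: row.
Qed.

(** The [m]-th power shifts each Jordan chain by [m], so its image has as basis the chain vectors in
    positions at least [m]. *)
Lemma dim_iter_image (K : fieldType) (V : vectType K) (phi : 'End(V)) P m (psi : 'End(V)) :
  nilp_jordan_type phi P -> (forall v, psi v = iter m phi v) ->
  \dim (limg psi) = excess P m.
Proof.
case=> _ [z [z0 /andP[/eqP spanE freeE]]] psiE.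
set f := fun rc : nat * nat => iter rc.2 phi (z rc.1) in spanE freeE.
pose p (rc : nat * nat) := (m <= rc.2)%N.
suff -> : limg psi = <<[seq f rc | rc <- cells P & p rc]>>%VS.
  have : perm_eq (map f (cells P))
      (map f (filter p (cells P)) ++ map f (filter (predC p) (cells P))).
    by rewrite -map_cat perm_map // perm_sym perm_filterC.
  move/perm_free; rewrite freeE => /esym/catl_free/eqP->.
  by rewrite size_map size_filter count_cells.
have iter0 k r : (r < size P)%N -> (nth 0%N P r <= k)%N -> iter k phi (z r) = 0.
  move=> lt_r le_k; rewrite -(subnK le_k) iterD z0 //.
  by elim: (k - _)%N => //= w ->; rewrite linear0.
have cellP rc : (rc \in cells P) = (rc.1 < size P)%N && (rc.2 < nth 0%N P rc.1)%N.
  apply/allpairsPdep/andP => [[r [c []]]|[lt1 lt2]].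
    by rewrite !mem_iota /= => lt1 lt2 ->.
  by exists rc.1, rc.2; rewrite !mem_iota /=; split=> //; case: rc lt1 lt2.
apply/eqP; rewrite eqEsubv -spanE limg_span; apply/andP; split; apply/span_subvP => v.
  case/mapP=> w /mapP[[r c] rc_in ->] ->{v w}; rewrite psiE -iterD /=.
  move: rc_in; rewrite cellP /= => /andP[lt1 lt2].
  have [lt_mc|le_mc] := ltnP (m + c) (nth 0%N P r); last by rewrite iter0 ?mem0v.
  apply/memv_span/mapP; exists (r, m + c)%N => //.
  by rewrite mem_filter cellP /= /p /= leq_addr lt1.
case/mapP=> [[r c]]; rewrite mem_filter cellP /p /= => /and3P[le_mc lt1 lt2] ->{v}.
apply/memv_span/mapP; exists (f (r, c - m)%N); last by rewrite psiE -iterD subnKC.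
by apply/map_f; rewrite cellP /= lt1; apply: leq_ltn_trans lt2; apply: leq_subr.
Qed.

(** * Action by differentiation and the socle form *)

Section Contraction.
Variable K : fieldType.
Implicit Types (f g F G ell : {mpoly K[2]}) (m : 'X_{1..2}).

Lemma diff_actwE k f F : (msize f <= k)%N ->
  diff_act f F = \sum_(m : 'X_{1..2 < k}) f@_m *: F^`M[m].
Proof.
pose I : subFinType _ := 'X_{1..2 < k}.
move=> le_fk; rewrite /diff_act (big_mksub I) /=; first last.
  by move=> x /msize_mdeg_lt/leq_trans/(_ le_fk).
  by rewrite msupp_uniq.
by rewrite big_rmcond //= => m /memN_msupp_eq0 ->; rewrite scale0r.
Qed.

(** The arguments are swapped so that linearity in [f] can be attached to [contract F]. *)
Definition contract F f := diff_act f F.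

Lemma contract_is_linear F : linear (contract F).
Proof.
move=> c f g; rewrite /contract; pose k := maxn (msize (c *: f + g)) (maxn (msize f) (msize g)).
rewrite !(@diff_actwE k) ?leq_max ?leqnn ?orbT //.
rewrite scaler_sumr -big_split /=; apply: eq_bigr => m _.
by rewrite scalerA -scalerDl mcoeffD mcoeffZ.
Qed.

HB.instance Definition _ F :=
  GRing.isLinear.Build K {mpoly K[2]} {mpoly K[2]} _ (contract F) (contract_is_linear F).

Lemma contractE F f : diff_act f F = contract F f. Proof. by []. Qed.

Lemma diff_actX m F : diff_act 'X_[m] F = F^`M[m].
Proof. by rewrite /diff_act msuppX big_seq1 mcoeffX eqxx scale1r. Qed.

Lemma diff_actM f g F : diff_act (f * g) F = diff_act f (diff_act g F).
Proof.
rewrite [f]mpolyE mulr_suml !contractE !linear_sum; apply: eq_bigr => m _.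
rewrite -scalerAl !linearZ; congr (_ *: _) => /=.
rewrite -[contract (diff_act g F) _]/(diff_act _ _) diff_actX.
rewrite !contractE [g]mpolyE mulr_sumr !(linear_sum (contract F)) linear_sum; apply: eq_bigr => m' _.
rewrite -scalerAr !linearZ /=; congr (_ *: _).
by rewrite -mpolyXD -!contractE !diff_actX addmC mderivmDm.
Qed.

Lemma diff_act_homog e n f F : f \is e.-homog -> F \is n.-homog ->
  diff_act f F \is (n - e).-homog.
Proof.
move=> f_e F_n; rewrite /diff_act big_seq; apply: rpred_sum => m /(dhomog_mf f_e) /= <-.
apply/rpredZ/dhomogP => m'; rewrite mcoeff_msupp mcoeff_mderivm => nz.
have /(dhomog_mf F_n) /= <- : (m + m')%MM \in msupp F.
  by rewrite mcoeff_msupp; apply: contra nz => /eqP->; rewrite mul0rn.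
by rewrite mdegD addKn.
Qed.

Lemma linear_formE ell : ell \is 1.-homog -> ell = \sum_i ell@_U_(i) *: 'X_i.
Proof.
move=> ell1; apply/mpolyP => m; rewrite raddf_sum /=.
under eq_bigr do rewrite mcoeffZ mcoeffX.
have [/eqP/mdeg1P[i /eqP->]|ne1] := eqVneq (mdeg m) 1%N.
  rewrite (bigD1 i) //= eqxx mulr1 big1 ?addr0 // => k ne_ki.
  by rewrite eq_mnm1 (negPf ne_ki) mulr0.
rewrite (dhomog_nemf_coeff ell1 ne1) big1 // => i _.
case: eqP => [Em|_]; last by rewrite mulr0.
by rewrite -Em mdeg1 in ne1.
Qed.

Lemma euler_monomial m (v : 'I_2 -> K) i :
  v i * ('X_[m]^`M(i)).@[v] = (m i)%:R * ('X_[m]).@[v].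
Proof.
rewrite mderivX mevalZ; case E: (m i) => [|k]; first by rewrite !mul0r mulr0.
have {2}-> : m = (U_(i) + (m - U_(i)))%MM.
  by rewrite addmC submK //; apply/mnm_lepP => l; rewrite mnm1E; case: eqP => // <-; rewrite E.
by rewrite mpolyXD mevalM mevalXU mulrCA.
Qed.

(** For [ell = a x + b y] this is Euler's identity for [a G_X + b G_Y], evaluated at [(a, b)]. *)
Lemma euler_point ell n G : ell \is 1.-homog -> G \is n.-homog ->
  (diff_act ell G).@[point_of ell] = n%:R * G.@[point_of ell].
Proof.
move=> ell1 G_n.
have -> : diff_act ell G = \sum_i ell@_U_(i) *: G^`M(i).
  rewrite {1}(linear_formE ell1) contractE (linear_sum (contract G)); apply: eq_bigr => i _.
  by rewrite linearZ /= -contractE diff_actX mderivmU1m.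
rewrite raddf_sum {2}[G]mpolyE raddf_sum mulr_sumr /=.
under eq_bigr => i _.
  rewrite mevalZ {1}[G]mpolyE (raddf_sum (mderiv i)) raddf_sum mulr_sumr /=.
  under eq_bigr => m _ do rewrite mderivZ mevalZ mulrCA -/(point_of ell i) euler_monomial.
  over.
rewrite exchange_big /=; apply: eq_big_seq => m /(dhomog_mf G_n) /= <-.
by rewrite mevalZ -mulr_sumr -mulr_suml mdegE natr_sum mulrCA.
Qed.

Lemma power_act_eval ell n G : ell \is 1.-homog -> G \is n.-homog ->
  (diff_act (ell ^+ n) G)@_0 = n`!%:R * G.@[point_of ell].
Proof.
move=> ell1; elim: n G => [|n IHn] G G_n.
  rewrite expr0 mul1r -mpolyX0 diff_actX mderivm0m.
  suff {2}-> : G = (G@_0)%:MP by rewrite mevalC.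
  apply/mpolyP => m; rewrite mcoeffC; case: eqP => [->|/eqP nz]; rewrite ?mulr1 ?mulr0 //.
  by rewrite (dhomog_nemf_coeff G_n) //= mdeg_eq0.
rewrite exprSr diff_actM IHn; last by have := diff_act_homog ell1 G_n; rewrite subn1.
by rewrite (euler_point ell1 G_n) mulrA -natrM mulnC -factS.
Qed.

(* The linear form on [R / Ann F] supported in the socle degree. *)
Definition socle F f : K := (contract F f)@_0.

Lemma socle_is_scalar F : scalar (socle F).
Proof. by move=> c f g; rewrite /socle linearP mcoeffD mcoeffZ. Qed.

HB.instance Definition _ F :=
  GRing.isLinear.Build K {mpoly K[2]} K _ (socle F) (socle_is_scalar F).

Lemma socle_homog e n f F : f \is e.-homog -> F \is n.-homog -> e != n -> socle F f = 0.
Proof.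
move=> f_e F_n ne_en; rewrite /socle /contract /diff_act raddf_sum big1_seq //= => m m_f.
rewrite mcoeffZ mcoeff_mderivm addm0 (dhomog_nemf_coeff F_n) ?mul0rn ?mulr0 //=.
by rewrite (dhomog_mf f_e).
Qed.

(** Pairing [f] with ['X_[m]] extracts the coefficient of [diff_act f F] at [m] times a product of
    factorials, which is nonzero in characteristic 0. *)
Lemma socle_nondegenerate F f : [pchar K] =i pred0 ->
  (forall m, socle F (f * 'X_[m]) = 0) -> diff_act f F = 0.
Proof.
move=> K0 f0; apply/mpolyP => m; rewrite mcoeff0; apply/eqP.
have := f0 m; rewrite mulrC /socle /contract diff_actM diff_actX mcoeff_mderivm addm0.
move/eqP; rewrite -mulr_natr mulf_eq0 => /orP[//|].
have /pcharf0P -> := K0; move=> /eqP prod0.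
have: (0 < \prod_(i < 2) m i ^_ m i)%N by apply: prodn_gt0 => i; rewrite ffact_gt0.
by rewrite prod0.
Qed.

(** * Coordinates adapted to a linear form *)

Lemma linear_form_compl ell : is_linear_form ell ->
  exists2 t, t \is 1.-homog & forall i, exists a b, 'X_i = a *: ell + b *: t.
Proof.
case=> ell1 nz_ell; have ellE := linear_formE ell1.
have [k nz_k] : exists k, ell@_U_(k) != 0.
  apply/existsP; apply: contraR nz_ell; rewrite negb_exists => /forallP c0.
  by rewrite ellE big1 // => i _; have /negPn/eqP-> := c0 i; rewrite scale0r.
(* Among two variables, [rev_ord k] is the index other than [k]. *)
exists 'X_(rev_ord k) => [|i]; first by rewrite dhomogX /= mdeg1.
have {}ellE : ell = ell@_U_(k) *: 'X_k + ell@_U_(rev_ord k) *: 'X_(rev_ord k).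
  rewrite {1}ellE (bigD1 k) //= (bigD1 (rev_ord k)) //=; last first.
    by rewrite -val_eqE /=; case: k {nz_k} => [[|[]]].
  rewrite big1 ?addr0 // => l /andP[]; rewrite -!val_eqE /=.
  by case: k {nz_k} => [[|[|//]] ?]; case: l => [[|[|//]] ?].
have [->|ne_ik] := eqVneq i k.
  exists (ell@_U_(k))^-1, (- (ell@_U_(k))^-1 * ell@_U_(rev_ord k)).
  rewrite [X in _ *: X]ellE scalerDr !scalerA mulVf // scale1r -addrA -scalerDl mulNr subrr.
  by rewrite scale0r addr0.
exists 0, 1; rewrite scale0r scale1r add0r; congr 'X__; apply/val_inj.
by move: ne_ik; rewrite -val_eqE /=; case: k {nz_k ellE} => [[|[|//]] ?]; case: i => [[|[|//]] ?].
Qed.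

Section Coordinates.
Variables (ell t : {mpoly K[2]}) (ell1 : ell \is 1.-homog) (t1 : t \is 1.-homog).
Hypothesis ell_t : forall i, exists a b, 'X_i = a *: ell + b *: t.

Definition form_basis e (s : 'I_e.+1) := ell ^+ (e - s) * t ^+ s.

Lemma form_basis_homog e s : @form_basis e s \is e.-homog.
Proof.
have := dhomogM (dhomogMn (e - s) ell1) (dhomogMn s t1).
by rewrite !mul1n subnK // -ltnS ltn_ord.
Qed.

(** The spans are stable under multiplication by [ell] and [t], hence by both variables; monomials
    follow by induction on the degree. *)
Lemma form_basis_span e f : f \is e.-homog ->
  exists c : 'I_e.+1 -> K, f = \sum_s c s *: form_basis s.
Proof.
pose S e f := exists c : 'I_e.+1 -> K, f = \sum_s c s *: form_basis s.
have S0 e' : S e' 0 by exists (fun=> 0); rewrite big1 // => s _; rewrite scale0r.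
have SD e' f1 f2 a : S e' f1 -> S e' f2 -> S e' (a *: f1 + f2).
  move=> [c1 ->] [c2 ->]; exists (fun s => a * c1 s + c2 s).
  rewrite scaler_sumr -big_split /=; apply: eq_bigr => s _.
  by rewrite scalerDl scalerA.
have SL e' f1 : S e' f1 -> S e'.+1 (ell * f1).
  move=> [c ->]; exists (fun s => if insub (val s) is Some s' then c s' else 0).
  rewrite [RHS]big_ord_recr /= insubF ?ltnn // scale0r addr0 mulr_sumr.
  apply: eq_bigr => s _; rewrite /= valK -scalerAr /form_basis /= mulrA -exprS.
  by rewrite subSn // -ltnS ltn_ord.
have ST e' f1 : S e' f1 -> S e'.+1 (t * f1).
  move=> [c ->]; exists (fun s => if unlift ord0 s is Some s' then c s' else 0).
  rewrite [RHS]big_ord_recl unlift_none scale0r add0r mulr_sumr.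
  apply: eq_bigr => s _; rewrite liftK -scalerAr /form_basis mulrCA -exprS.
  by rewrite lift0 subSS.
have SX e' f1 i : S e' f1 -> S e'.+1 ('X_i * f1).
  move=> Sf1; have [a [b ->]] := ell_t i.
  rewrite mulrDl -!scalerAl; apply: (SD); first exact: SL.
  by rewrite -[_ *: _]addr0; apply: (SD); [apply: ST | apply: S0].
have SM m : S (mdeg m) 'X_[m].
  move: {-2}(mdeg m) (erefl (mdeg m)) => n; elim: n m => [|n IHn] m Em.
    exists (fun=> 1); rewrite big_ord1 scale1r /form_basis !expr0 mulr1.
    by move/esym/eqP: Em; rewrite mdeg_eq0 => /eqP->; rewrite mpolyX0.
  have [i nz_i] : exists i, (0 < m i)%N.
    apply/existsP; rewrite -[[exists _, _]]negbK negb_exists; apply/negP => /forallP m0.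
    by move/esym/eqP: Em; rewrite mdegE big1 // => i _; have := m0 i; rewrite lt0n negbK => /eqP.
  have mE : m = (U_(i) + (m - U_(i)))%MM.
    by rewrite addmC submK //; apply/mnm_lepP => l; rewrite mnm1E; case: eqP => // <-.
  rewrite mE mpolyXD; apply/SX/IHn.
  by apply: succn_inj; rewrite Em {1}mE mdegD mdeg1.
move=> f_e; rewrite [f]mpolyE big_seq; elim/big_ind: _ => [|f1 f2 S1 S2|m /(dhomog_mf f_e) /= <-].
- exact: S0.
- by rewrite -[f1]scale1r; apply: SD.
by rewrite -[_ *: _]addr0; apply: SD; [apply: SM | apply: S0].
Qed.
End Coordinates.
End Contraction.

(** * Graded pieces, powers of a linear form and Hessians of the quotient *)

Section Families.
Import VectorInternalTheory.
Variables (K : fieldType) (V : vectType K) (p : nat) (w : 'I_p -> V).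
Let W := <<[seq w i | i <- enum 'I_p]>>%VS.

Lemma family_tupleE : [seq w i | i <- enum 'I_p] = [tuple w i | i < p].
Proof. by []. Qed.

Lemma span_familyP v : reflect (exists c : 'I_p -> K, v = \sum_i c i *: w i) (v \in W).
Proof.
apply: (iffP idP) => [|[c ->]].
  rewrite /W family_tupleE => /coord_span ->.
  exists (fun i => coord [tuple w i | i < p] i v).
  by apply: eq_bigr => i _; rewrite -tnth_nth tnth_mktuple.
by apply: memv_suml => i _; apply/memvZ/memv_span/map_f/mem_enum.
Qed.

(** A family and a matrix with the same linear relations among their [p] members have the same rank;
    [B] is the matrix of coordinates of the family. *)
Lemma dim_span_gram q (M : 'M[K]_(p, q)) :
  (forall c : 'I_p -> K, \sum_i c i *: w i = 0 <-> \row_i c i *m M = 0) ->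
  \dim W = \rank M.
Proof.
move=> kerE; pose B := b2mx [tuple w i | i < p].
have rkB : \dim W = \rank B.
  by rewrite /W family_tupleE unlock /dimv tvalK; case: _ / (esym _); rewrite mx2vsK.
have kerB (c : 'rV_p) : (c *m B == 0) = (c *m M == 0).
  have -> : (c *m M == 0) = (\sum_i c 0 i *: w i == 0).
    have {1}-> : c = \row_i c 0 i by apply/rowP => i; rewrite mxE.
    by apply/eqP/eqP => /kerE.
  have -> : \sum_i c 0 i *: w i = r2v (c *m B).
    rewrite mulmx_sum_row linear_sum; apply: eq_bigr => i _.
    by rewrite linearZ /= b2mxK -tnth_nth tnth_mktuple.
  by rewrite -(inj_eq (@v2r_inj _ V) (r2v _)) r2vK linear0.
have eq_ker : (kermx B :=: kermx M)%MS.
  apply/eqmxP/andP; split; apply/rV_subP => c; rewrite !sub_kermx => cB.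
    by rewrite -kerB.
  by rewrite kerB.
have := mxrank_ker B; rewrite eq_ker mxrank_ker rkB.
by move: (rank_leq_row B) (rank_leq_row M); lia.
Qed.
End Families.

Section Quotient.
Variables (K : fieldType) (charK : [pchar K] =i pred0) (A : falgType K).
Variables (pi : {lrmorphism {mpoly K[2]} -> A}) (pi_quot : is_quotient pi).
Variables (F : {mpoly K[2]}) (j : nat) (F_j : F \is j.-homog) (kerF : kernel_is_Ann pi F).
Implicit Types (f g : {mpoly K[2]}).

Lemma pi_diff_act f g : pi f = pi g -> diff_act f F = diff_act g F.
Proof.
move=> eq_fg; have : diff_act (f - g) F = 0 by apply/kerF; rewrite linearB /= eq_fg subrr.
by rewrite contractE linearB /= => /eqP; rewrite subr_eq0 => /eqP.
Qed.

Lemma pi_socle f g : pi f = pi g -> socle F f = socle F g.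
Proof. by rewrite /socle -!contractE => /pi_diff_act->. Qed.

(** Gorenstein duality: [socle F] vanishes outside degree [j], so testing in the complementary
    degree amounts to testing against all monomials. *)
Lemma pi_homog_eq0 e f : f \is e.-homog ->
  (forall e' g, (e + e' = j)%N -> g \is e'.-homog -> socle F (f * g) = 0) -> pi f = 0.
Proof.
move=> f_e f0; apply/kerF/socle_nondegenerate => // m.
have X_m : 'X_[K, m] \is (mdeg m).-homog by rewrite dhomogX.
have [eqj|nej] := eqVneq (e + mdeg m)%N j; first exact: f0 X_m.
exact: socle_homog (dhomogM f_e X_m) F_j nej.
Qed.

Lemma gr_pieceE i :
  gr_piece pi i = <<[seq pi ('X_ord0 ^+ a * 'X_ord_max ^+ (i - a))%R | a : 'I_i.+1 <- enum 'I_i.+1]>>%VS.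
Proof. by rewrite /gr_piece -val_enum_ord -map_comp. Qed.

Lemma gr_pieceP i a : reflect (exists2 f, f \is i.-homog & pi f = a) (a \in gr_piece pi i).
Proof.
rewrite gr_pieceE; apply: (iffP idP) => [/span_familyP[c ->]|[f f_i <-]].
  exists (\sum_(s < i.+1) c s *: ('X_ord0 ^+ s * 'X_ord_max ^+ (i - s))).
    apply: rpred_sum => s _; apply: rpredZ.
    have X1 (u : 'I_2) : ('X_u : {mpoly K[2]}) \is 1.-homog by rewrite dhomogX /= mdeg1.
    have := dhomogM (dhomogMn s (X1 ord0)) (dhomogMn (i - s) (X1 ord_max)).
    by rewrite !mul1n subnKC // -ltnS.
  by rewrite linear_sum; apply: eq_bigr => s _; rewrite linearZ.
rewrite [f]mpolyE linear_sum big_seq; apply: memv_suml => m /(dhomog_mf f_i) /= mi.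
rewrite linearZ; apply/memvZ/memv_span/mapP.
have lt_m : (m ord0 < i.+1)%N by rewrite ltnS -mi mdegE big_ord_recl leq_addr.
exists (Ordinal lt_m); first exact: mem_enum.
have lift_max : lift ord0 ord0 = ord_max :> 'I_2 by apply/val_inj.
have mi' : (i - m ord0 = m ord_max)%N by rewrite -mi mdegE big_ord_recl big_ord1 addKn lift_max.
by rewrite mpolyXE_id big_ord_recl big_ord1 lift_max /= mi'.
Qed.

Lemma span_forms n i (w : 'I_n -> {mpoly K[2]}) : (forall s, w s \is i.-homog) ->
  (forall f, f \is i.-homog -> exists c : 'I_n -> K, f = \sum_s c s *: w s) ->
  <<[seq pi (w s) | s <- enum 'I_n]>>%VS = gr_piece pi i.
Proof.
move=> w_i w_span; apply/eqP; rewrite eqEsubv; apply/andP; split; apply/subvP => a.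
  move/span_familyP => [c ->]; apply: memv_suml => s _; apply: memvZ.
  by apply/gr_pieceP; exists (w s).
move/gr_pieceP => [f /w_span[c ->] <-]; apply/span_familyP; exists c.
by rewrite linear_sum; apply: eq_bigr => s _; rewrite linearZ.
Qed.

Variables (ell t : {mpoly K[2]}) (ell1 : ell \is 1.-homog) (t1 : t \is 1.-homog).
Hypothesis ell_t : forall i, exists a b, 'X_i = a *: ell + b *: t.

(** The sequence [b_s] of the introduction; the truncated exponent [j - s] makes it meaningful only
    for [s <= j]. *)
Definition moments s := socle F (ell ^+ (j - s) * t ^+ s).

Lemma moments_gram m i e' (s : 'I_i.+1) (v : 'I_e'.+1) : (m + i + e' = j)%N ->
  socle F (ell ^+ m * form_basis ell t s * form_basis ell t v) = moments (s + v).
Proof.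
move=> Ej; rewrite /moments /form_basis; congr (socle F _).
have -> : (j - (s + v) = m + (i - s) + (e' - v))%N.
  by have := ltn_ord s; have := ltn_ord v; lia.
by rewrite !exprD -!mulrA; do 2!congr (_ * _); rewrite mulrCA.
Qed.

(** The image of [ell ^+ m] on degree [i] is tested against degree [j - m - i]. The pairing of the
    monomials in [ell] and [t] depends only on the sum of their exponents in [t], so the Gram matrix
    is Hankel. *)
Lemma dim_shifted_piece m i :
  \dim <<[seq pi (ell ^+ m * form_basis ell t s)%R | s : 'I_i.+1 <- enum 'I_i.+1]>>
  = \rank (hankel moments i.+1 (j.+1 - m - i)).
Proof.
apply: dim_span_gram => c; set h := \sum_s c s *: form_basis ell t s.
have h_i : h \is i.-homog by apply: rpred_sum => s _; apply/rpredZ/form_basis_homog.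
have -> : \sum_s c s *: pi (ell ^+ m * form_basis ell t s) = pi (ell ^+ m * h).
  by rewrite mulr_sumr linear_sum; apply: eq_bigr => s _; rewrite -scalerAr linearZ.
have gram e' (v : 'I_e'.+1) : (m + i + e' = j)%N ->
    socle F (ell ^+ m * h * form_basis ell t v) = \sum_s c s * moments (s + v).
  move=> Ej; rewrite mulr_sumr mulr_suml linear_sum; apply: eq_bigr => s _.
  by rewrite -scalerAr -scalerAl linearZ /= (moments_gram _ _ Ej).
split=> [h0|c0].
  apply/rowP => v; rewrite !mxE.
  (* The existence of a column [v] forces [m + i <= j]. *)
  have lt_v := ltn_ord v; have Ej : (m + i + (j - m - i) = j)%N by lia.
  have lt_v' : (v < (j - m - i).+1)%N by lia.
  transitivity (socle F (ell ^+ m * h * form_basis ell t (Ordinal lt_v'))).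
    by rewrite (gram _ _ Ej); apply: eq_bigr => s _; rewrite !mxE.
  rewrite (@pi_socle _ 0) ?linear0 //.
  by rewrite rmorphM /= h0 mul0r.
have hm : ell ^+ m * h \is (m + i).-homog.
  by have := dhomogM (dhomogMn m ell1) h_i; rewrite mul1n.
apply: pi_homog_eq0 hm _ => e' g Ej g_e'.
have [c' ->] := form_basis_span ell_t g_e'.
rewrite mulr_sumr linear_sum big1 // => v _; rewrite -scalerAr linearZ /= (gram _ _ Ej).
have lt_v : (v < j.+1 - m - i)%N by have := ltn_ord v; lia.
move/rowP/(_ (Ordinal lt_v)): c0; rewrite !mxE => c0.
rewrite (_ : \sum_s _ = 0) ?mulr0 // -[RHS]c0.
by apply: eq_bigr => s _; rewrite !mxE.
Qed.

Lemma dim_gr_piece i : \dim (gr_piece pi i) = \rank (hankel moments i.+1 (j.+1 - i)).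
Proof.
rewrite -[j.+1]subn0 -dim_shifted_piece; congr (\dim _); apply/esym.
rewrite -(@span_forms _ _ (@form_basis _ ell t i)) => [||f f_i].
- by congr <<_>>%VS; apply: eq_map => s; rewrite expr0 mul1r.
- by move=> s; apply: form_basis_homog.
exact: form_basis_span.
Qed.

Lemma dim_power_image m (psi : 'End(A)) : (forall a, psi a = pi ell ^+ m * a) ->
  \dim (limg psi) = (\sum_(i < j.+1) \rank (hankel moments i.+1 (j.+1 - m - i)))%N.
Proof.
move=> psiE; pose W (i : 'I_j.+1) : {vspace A} :=
  <<[seq pi (ell ^+ m * form_basis ell t s)%R | s : 'I_i.+1 <- enum 'I_i.+1]>>%VS.
have WP i a : a \in W i -> exists2 f, f \is i.-homog & pi (ell ^+ m * f) = a.
  move/span_familyP => [c ->]; exists (\sum_s c s *: form_basis ell t s).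
    by apply: rpred_sum => s _; apply/rpredZ/form_basis_homog.
  by rewrite mulr_sumr linear_sum; apply: eq_bigr => s _; rewrite -scalerAr linearZ.
have -> : limg psi = (\sum_i W i)%VS.
  apply/eqP; rewrite eqEsubv; apply/andP; split; apply/subvP => a.
    move/memv_imgP => [a' _ ->]; rewrite psiE; have [f <-] := pi_quot a'.
    have -> : pi ell ^+ m * pi f = pi (ell ^+ m * f) by rewrite rmorphM rmorphXn.
    rewrite [f]mpolyE mulr_sumr linear_sum /=.
    apply: memv_suml => mm _; rewrite -scalerAr linearZ /=; apply: memvZ.
    have X_mm : 'X_[K, mm] \is (mdeg mm).-homog by rewrite dhomogX.
    have lX : ell ^+ m * 'X_[K, mm] \is (m + mdeg mm).-homog.
      by have := dhomogM (dhomogMn m ell1) X_mm; rewrite mul1n.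
    have [le_mm|gt_mm] := leqP (mdeg mm) j; last first.
      (* Above degree [j] there is no complementary degree, so duality applies vacuously. *)
      by rewrite (pi_homog_eq0 lX) ?mem0v // => e' g Ej; lia.
    rewrite memvE; apply: (@sumv_sup _ _ _ (inord (mdeg mm))) => //.
    rewrite -memvE /W inordK //; have [c ->] := form_basis_span ell_t X_mm.
    apply/span_familyP; exists c.
    by rewrite mulr_sumr linear_sum; apply: eq_bigr => s _; rewrite -scalerAr linearZ.
  move: a; apply/subvP/subv_sumP => i _; apply/subvP => a /WP[f _ <-].
  by rewrite rmorphM rmorphXn -psiE memv_img ?memvf.
(* The sum is direct because pairing with a form complementary to one degree kills the components in
   all others. *)
have /directvP /= -> : directv (\sum_i W i).
  apply/directv_sum_independent => us Wus us0 i _.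
  have [f f_homog usE] := fin_all_exists2 (fun k => WP k _ (Wus k isT)).
  have lf k : ell ^+ m * f k \is (m + k).-homog.
    by have := dhomogM (dhomogMn m ell1) (f_homog k); rewrite mul1n.
  rewrite -usE; apply: pi_homog_eq0 (lf i) _ => e' g Ej g_e'.
  have : socle F ((\sum_k ell ^+ m * f k) * g) = 0.
    rewrite (@pi_socle _ 0) ?linear0 // rmorphM /= linear_sum /=.
    by rewrite (eq_bigr us) ?us0 ?mul0r // => k _; apply: usE.
  rewrite mulr_suml linear_sum (bigD1 i) //= big1 ?addr0 // => k ne_ki.
  apply: socle_homog (dhomogM (lf k) g_e') F_j _.
  by move: ne_ki; rewrite -val_eqE /=; lia.
by apply: eq_bigr => i _; apply: dim_shifted_piece.
Qed.

(** The right-hand side, nondegeneracy of a bilinear form on the graded piece, does not mention [w];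
    this is what allows changing the basis. *)
Lemma gram_det_neq0 m i (w : 'I_i.+1 -> {mpoly K[2]}) :
  represents_basis pi i w ->
  \det (\matrix_(u, v) socle F (ell ^+ m * (w u * w v))) != 0 <->
  (forall f, f \is i.-homog ->
     (forall g, g \is i.-homog -> socle F (ell ^+ m * (f * g)) = 0) -> pi f = 0).
Proof.
set M := \matrix_(u, v) _ => /andP[/eqP spanE freeE].
have w_spanP a : reflect (exists c : 'I_i.+1 -> K, a = \sum_s c s *: pi (w s)) (a \in gr_piece pi i).
  by rewrite -spanE; apply: span_familyP.
have rowM (c : 'rV_i.+1) f : pi f = \sum_s c 0 s *: pi (w s) ->
    forall v, (c *m M) 0 v = socle F (ell ^+ m * (f * w v)).
  move=> fE v; transitivity (socle F (ell ^+ m * ((\sum_s c 0 s *: w s) * w v))).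
    rewrite mulr_suml mulr_sumr linear_sum mxE; apply: eq_bigr => s _.
    by rewrite !mxE -scalerAl -scalerAr linearZ.
  apply: pi_socle; rewrite !rmorphM /=; congr (_ * (_ * _)).
  by rewrite fE linear_sum; apply: eq_bigr => s _; rewrite linearZ.
rewrite -unitfE -unitmxE -row_free_unit -kermx_eq0; split=> [/eqP ker0 f f_i f0|nondeg].
  have /w_spanP[c fE] : pi f \in gr_piece pi i by apply/gr_pieceP; exists f.
  suff c0 : \row_s c s = 0.
    by rewrite fE big1 // => s _; move/rowP/(_ s): c0; rewrite !mxE => ->; rewrite scale0r.
  suff /sub_kermxP : \row_s c s *m M = 0 by rewrite ker0 submx0 => /eqP.
  apply/rowP => v; rewrite (@rowM _ f); last first.
    by rewrite fE; apply: eq_bigr => s _; rewrite mxE.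
  have /gr_pieceP[g g_i gE] : pi (w v) \in gr_piece pi i.
    by rewrite -spanE; apply/memv_span/map_f/mem_enum.
  by rewrite mxE -(f0 g) //; apply: pi_socle; rewrite !rmorphM /= gE.
apply/rowV0P => c /sub_kermxP c0.
have : \sum_s c 0 s *: pi (w s) \in gr_piece pi i by apply/w_spanP; exists (c 0).
case/gr_pieceP => f f_i fE.
suff pif : pi f = 0.
  apply/rowP => s; rewrite mxE; move: freeE; rewrite family_tupleE => /freeP.
  apply; rewrite -[RHS]pif fE; apply: eq_bigr => s' _.
  by rewrite -tnth_nth tnth_mktuple.
apply: nondeg => // g g_i.
have /w_spanP[c' gE] : pi g \in gr_piece pi i by apply/gr_pieceP; exists g.
rewrite (@pi_socle _ (\sum_v c' v *: (ell ^+ m * (f * w v)))).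
  by rewrite linear_sum big1 // => v _; rewrite linearZ /= -(rowM c) // c0 mxE mulr0.
rewrite !rmorphM /= gE linear_sum !mulr_sumr; apply: eq_bigr => v _.
by rewrite linearZ /= !rmorphM /= -!scalerAr.
Qed.

(** With [m = j - 2 * i], [power_act_eval] makes the evaluated Hessian matrix, up to the factor
    [m!], the Gram matrix of [w]; in the basis [form_basis] that Gram matrix is Hankel. *)
Lemma hessian_neq0 i (w : 'I_i.+1 -> {mpoly K[2]}) : (2 * i <= j)%N ->
  represents_basis pi i w -> \dim (gr_piece pi i) = i.+1 ->
  (hessian w F).@[point_of ell] != 0 <-> row_free (hankel moments i.+1 i.+1).
Proof.
move=> le_ij w_basis dim_i; set m := (j - 2 * i)%N.
have e_basis : represents_basis pi i (@form_basis _ ell t i).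
  rewrite /represents_basis basisEdim size_map size_enum_ord dim_i leqnn andbT.
  rewrite (@span_forms _ i (@form_basis _ ell t i)) // => [s|f f_i].
    exact: form_basis_homog.
  exact: form_basis_span.
have -> : hankel moments i.+1 i.+1 =
    \matrix_(u, v) socle F (ell ^+ m * (form_basis ell t u * form_basis ell t v)).
  by apply/matrixP => u v; rewrite !mxE mulrA moments_gram // /m; lia.
rewrite row_free_unit unitmxE unitfE.
apply: iff_trans (iff_sym (gram_det_neq0 m e_basis)).
apply: iff_trans (gram_det_neq0 m w_basis).
have -> : \matrix_(u, v) socle F (ell ^+ m * (w u * w v)) =
    m`!%:R *: map_mx (meval (point_of ell)) (\matrix_(u < i.+1, v < i.+1) diff_act (w u * w v) F).
  apply/matrixP => u v; rewrite !mxE.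
  (* The representatives [w u] need not be homogeneous, whereas Euler's identity needs forms; they
     are replaced modulo the kernel of [pi]. *)
  have [f f_i fE] : exists2 f, f \is i.-homog & pi f = pi (w u).
    apply/gr_pieceP; case/andP: w_basis => /eqP <- _; apply/memv_span/map_f/mem_enum.
  have [g g_i gE] : exists2 g, g \is i.-homog & pi g = pi (w v).
    apply/gr_pieceP; case/andP: w_basis => /eqP <- _; apply/memv_span/map_f/mem_enum.
  have fgE : pi (w u * w v) = pi (f * g) by rewrite !rmorphM /= fE gE.
  rewrite (pi_diff_act fgE) (@pi_socle _ (ell ^+ m * (f * g))); last first.
    by rewrite !(rmorphM _ (ell ^+ m)) /= fgE.
  rewrite /socle -contractE diff_actM power_act_eval //.
  by have := diff_act_homog (dhomogM f_i g_i) F_j; rewrite /m mul2n addnn.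
rewrite detZ mulf_eq0 negb_or /hessian det_map_mx.
have -> : (m`!%:R ^+ i.+1 != 0 :> K).
  by have /pcharf0P natr0 := charK; rewrite expf_eq0 natr0 -lt0n fact_gt0.
by [].
Qed.
End Quotient.

(** * Values of the Hilbert function and comparison of the two algebras *)

Lemma nth_hilbT_small d k i : (0 < k)%N -> (i < d)%N -> nth 0%N (hilbT d k) i = i.+1.
Proof.
move=> k_gt0 lt_id; rewrite /hilbT nth_cat size_iota; case: ltnP => [lt_i|le_i].
  by rewrite nth_iota.
by rewrite nth_cat size_nseq nth_nseq !ifT //; lia.
Qed.

Lemma nth_hilbT_le d k i : (nth 0%N (hilbT d k) i <= d)%N.
Proof.
have [lt_i|le_i] := ltnP i (size (hilbT d k)); last by rewrite nth_default.
have : all (fun x => x <= d)%N (hilbT d k).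
  rewrite /hilbT !all_cat all_rev all_nseq leqnn orbT andTb andbb.
  by apply/allP => x; rewrite mem_iota; lia.
by move/all_nthP; apply.
Qed.

Lemma jordan_hessian_moments (K : fieldType) (charK : [pchar K] =i pred0)
    (d k j : nat) (d_gt0 : (0 < d)%N) (k_gt0 : (0 < k)%N) (jE : j = (2 * d + k - 3)%N)
    (P : seq nat) (F : {mpoly K[2]}) (F_j : F \is j.-homog) (A : falgType K)
    (pi : {lrmorphism {mpoly K[2]} -> A}) (A_ci : graded_ci pi)
    (A_F : kernel_is_Ann pi F) (A_T : has_hilbert_function pi (hilbT d k))
    (ell : {mpoly K[2]}) (ell_lin : is_linear_form ell) (P_type : has_jordan_type pi ell P)
    (alpha : forall i : 'I_d, 'I_i.+1 -> {mpoly K[2]})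
    (alpha_basis : forall i : 'I_d, represents_basis pi i (alpha i)) :
  exists b : nat -> K, [/\ apolar_order b j.+1 = d,
    forall m, excess P m = (\sum_(i < j.+1)
      minn (minn i.+1 (j.+1 - m - i)) (apolar_order b (j.+1 - m)))%N
    & forall i : 'I_d, (i \in hess_set alpha F ell) = (apolar_order b (2 * i).+1 == i.+1)].
Proof.
have [t t1 ell_t] := linear_form_compl ell_lin; have [ell1 _] := ell_lin.
have [pi_quot _] := A_ci.
exists (moments F j ell t); split=> [|m|i].
(* At full length the Hankel ranks are the values of [hilbT d k], so the order is the first degree
   where the value differs from [i.+1], namely [d]. *)
- have freeE i : (i < apolar_order (moments F j ell t) j.+1)%N = (nth 0%N (hilbT d k) i == i.+1).
    by rewrite -row_free_hankel /row_free -A_T (dim_gr_piece charK F_j A_F ell1 t1 ell_t).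
  apply/eqP; rewrite eqn_leq; apply/andP; split.
    by rewrite leqNgt freeE neq_ltn ltnS nth_hilbT_le.
  have lt_d : (d.-1 < d)%N by lia.
  by rewrite -(prednK d_gt0) freeE nth_hilbT_small.
- rewrite -(@dim_iter_image _ _ (amull (pi ell)) P m (amull (pi ell ^+ m)) P_type).
    rewrite (dim_power_image charK pi_quot F_j A_F ell1 t1 ell_t (m := m)) => [|a].
      by apply: eq_bigr => i _; rewrite mxrank_hankel.
    by rewrite lfunE.
  move=> v; elim: m => [|m IHm]; first by rewrite lfunE /= expr0 mul1r.
  by rewrite iterS -IHm !lfunE /= mulrA -exprS.
have lt_id := ltn_ord i; have le_ij : (2 * i <= j)%N by lia.
have dim_i : \dim (gr_piece pi i) = i.+1 by rewrite A_T nth_hilbT_small.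
have hess := hessian_neq0 charK F_j A_F ell1 t1 ell_t le_ij (alpha_basis i) dim_i.
rewrite inE; transitivity (row_free (hankel (moments F j ell t) i.+1 i.+1)).
  by apply/idP/idP => /hess.
(* Length [2 * i + 1] makes the matrix square, and there the order is at most [i.+1], so exceeding
   [i] means equality. *)
have := row_free_hankel (moments F j ell t) (2 * i).+1 i.
have -> : ((2 * i).+1 - i = i.+1)%N by lia.
move=> ->; have := apolar_order_bound (moments F j ell t) (2 * i).+1.
by move=> bd; apply/idP/eqP; lia.
Qed.

Theorem theorem3p15 (K : fieldType) (charK : [pchar K] =i pred0)
  (d k : nat) (d_gt0 : (0 < d)%N) (k_gt0 : (0 < k)%N)
  (P Q : seq nat)
  (P_cijt : is_CIJT K (hilbT d k) P) (Q_cijt : is_CIJT K (hilbT d k) Q)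
  (F F' : {mpoly K[2]})
  (F_homog : F \is (2 * d + k - 3)%N.-homog)
  (F'_homog : F' \is (2 * d + k - 3)%N.-homog)
  (A A' : falgType K)
  (pi : {lrmorphism {mpoly K[2]} -> A})
  (pi' : {lrmorphism {mpoly K[2]} -> A'})
  (A_ci : graded_ci pi) (A'_ci : graded_ci pi')
  (A_F : kernel_is_Ann pi F) (A'_F' : kernel_is_Ann pi' F')
  (A_T : has_hilbert_function pi (hilbT d k))
  (A'_T : has_hilbert_function pi' (hilbT d k))
  (ell ell' : {mpoly K[2]})
  (ell_lin : is_linear_form ell) (ell'_lin : is_linear_form ell')
  (P_type : has_jordan_type pi ell P) (Q_type : has_jordan_type pi' ell' Q)
  (alpha alpha' : forall i : 'I_d, 'I_i.+1 -> {mpoly K[2]})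
  (alpha_basis : forall i : 'I_d, represents_basis pi i (alpha i))
  (alpha'_basis : forall i : 'I_d, represents_basis pi' i (alpha' i)) :
  dominance_le Q P <->
  hess_set alpha' F' ell' \subset hess_set alpha F ell.
Proof.
have [b [b_d b_ex b_hess]] := jordan_hessian_moments charK d_gt0 k_gt0 (erefl _)
  F_homog A_ci A_F A_T ell_lin P_type alpha_basis.
have [b' [b'_d b'_ex b'_hess]] := jordan_hessian_moments charK d_gt0 k_gt0 (erefl _)
  F'_homog A'_ci A'_F' A'_T ell'_lin Q_type alpha'_basis.
set n0 := (2 * d + k - 3).+1 in b_d b_ex b'_d b'_ex.
(* At [m = 0] both excesses depend only on the common order [d] at full length. *)
have sumPQ : sumn P = sumn Q.
  by rewrite -!excess0 b_ex b'_ex subn0 b_d b'_d.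
apply: (iff_trans (dominance_leP P_type.1 Q_type.1 sumPQ)).
have excess_le m : (excess Q m <= excess P m)%N
    = (apolar_order b' (n0 - m) <= apolar_order b (n0 - m))%N.
  by rewrite b_ex b'_ex sum_minn_mono ?leq_subr ?apolar_order_bound.
split=> [le_ex|sub].
  apply/subsetP => i; rewrite b_hess b'_hess => /eqP hit.
  have le_i : ((2 * i).+1 <= n0)%N by have := ltn_ord i; rewrite /n0; lia.
  (* This power leaves a truncation of length [2 * i + 1], where [i.+1] is the largest possible
     order. *)
  have := le_ex (n0 - (2 * i).+1)%N; rewrite excess_le subKn // hit.
  by have := apolar_order_bound b (2 * i).+1; lia.
move=> m; rewrite excess_le; apply: (apolar_order_le_of_hits b_d b'_d) (leq_subr _ _).
move=> i lt_id hit; apply/eqP; rewrite -(b_hess (Ordinal lt_id)).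
by apply: (subsetP sub); rewrite b'_hess /= hit.
Qed.
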